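(* Let $T$ be a complete NIP theory with monster model $\mathfrak{C}$, let $\tilde{G}$ be a definable group of $T$, and let $G\leqslant\tilde{G}$ be a type-definable subgroup (over a small parameter set) which is dp-minimal. If $G$ is torsion-free, then $G$ is abelian.
   Context: ''Small'' means of cardinality less than the degree of saturation of $\mathfrak{C}$. A type-definable group $G$ is identified with the abstract group $G(\mathfrak{C})$. Dp-minimal: sequences $I_1,I_2$ are mutually indiscernible over $B$ if each is indiscernible over $B$ together with the other. $G$ is dp-minimal if for some (equivalently any) small set $B$ over which $G$ is type-defined, for any infinite sequences $I_1,I_2$ mutually indiscernible over $B$ and any $a\in G$, one of $I_1,I_2$ is indiscernible over $B\cup\{a\}$. *)

(* Defs.v *)
From mathcomp Require Import all_boot all_order.
From mathcomp Require Import mathcomp_extra boolp classical_sets functions cardinality.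

Set Implicit Arguments.
Unset Strict Implicit.
Unset Printing Implicit Defensive.

Local Open Scope classical_set_scope.
Local Open Scope card_scope.

Record language := Language {
  fsymb : Type;
  farity : fsymb -> nat;
  rsymb : Type;
  rarity : rsymb -> nat }.

(* Terms and formulas have their free variables in an arbitrary type V; the
   variable bound by FAll is None.  Equality, falsum, implication and the
   universal quantifier are primitive; the semantics being classical, the
   other connectives are definable from them. *)
Inductive term (L : language) (V : Type) : Type :=
| TVar of V
| TApp (f : fsymb L) of ('I_(farity f) -> term L V).

Inductive formula (L : language) (V : Type) : Type :=
| FEq of term L V & term L V
| FRel (r : rsymb L) of ('I_(rarity r) -> term L V)
| FFalse
| FImp of formula L V & formula L V
| FAll of formula L (option V).

Arguments TVar {L V}.
Arguments TApp {L V}.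
Arguments FEq {L V}.
Arguments FRel {L V}.
Arguments FFalse {L V}.
Arguments FImp {L V}.
Arguments FAll {L V}.

Definition sentence (L : language) := formula L void.

Definition FNot (L : language) (V : Type) (phi : formula L V) : formula L V :=
  FImp phi FFalse.

Record structure (L : language) := Structure {
  carrier :> Type;
  carrier_inhabited : inhabited carrier;
  finterp : forall f : fsymb L, ('I_(farity f) -> carrier) -> carrier;
  rinterp : forall r : rsymb L, ('I_(rarity r) -> carrier) -> Prop }.

Section Semantics.
Context {L : language} (M : structure L).

Fixpoint teval {V : Type} (v : V -> M) (t : term L V) : M :=
  match t with
  | TVar x => v x
  | TApp f args => finterp (fun i => teval v (args i))
  end.

Definition extend {V : Type} (v : V -> M) (m : M) (x : option V) : M :=
  if x is Some y then v y else m.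

Fixpoint sat {V : Type} (v : V -> M) (phi : formula L V) : Prop :=
  match phi with
  | FEq t u => teval v t = teval v u
  | FRel r args => rinterp (fun i => teval v (args i))
  | FFalse => False
  | FImp phi1 phi2 => sat v phi1 -> sat v phi2
  | FAll phi1 => forall m : M, sat (extend v m) phi1
  end.

Definition join {V W : Type} (v : V -> M) (w : W -> M) (x : V + W) : M :=
  match x with inl y => v y | inr z => w z end.

(* L(A)-formulas in the variables V are L-formulas in the variables V + A, the
   elements of the parameter set A being interpreted as themselves. *)
Definition satA {A : set M} {V : Type} (v : V -> M) (phi : formula L (V + A)) :
    Prop :=
  sat (join v (fun c : A => val c)) phi.

Definition models (T : set (sentence L)) : Prop :=
  forall phi, T phi -> sat (of_void M) phi.

Definition definable_over (A : set M) (V : Type) (X : set (V -> M)) : Prop :=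
  exists phi : formula L (V + A), X = [set v | satA v phi].

Definition definable (V : Type) (X : set (V -> M)) : Prop :=
  definable_over setT X.

Definition type_definable_over (A : set M) (V : Type) (X : set (V -> M)) :
    Prop :=
  exists pi : set (formula L (V + A)),
    X = [set v | forall phi, pi phi -> satA v phi].

Definition has_IP {p q : nat} (phi : formula L ('I_p + 'I_q)) : Prop :=
  forall N : nat, exists a : 'I_N -> 'I_p -> M,
    forall S : {set 'I_N}, exists b : 'I_q -> M,
      forall i, sat (join (a i) b) phi <-> i \in S.

(* A sequence of k-tuples indexed by a linear order. *)
Definition indiscernible_over (A : set M) (d : Order.disp_t) (I : orderType d)
    (k : nat) (a : I -> 'I_k -> M) : Prop :=
  forall (r : nat) (i j : 'I_r -> I),
    {homo i : s t / (s < t)%N >-> (s < t)%O} ->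
    {homo j : s t / (s < t)%N >-> (s < t)%O} ->
    forall phi : formula L ('I_r * 'I_k + A),
      satA (fun x => a (i x.1) x.2) phi <-> satA (fun x => a (j x.1) x.2) phi.

Definition entries (I : Type) (k : nat) (a : I -> 'I_k -> M) : set M :=
  [set c | exists i s, c = a i s].

Definition mutually_indiscernible_over (B : set M)
    (d1 d2 : Order.disp_t) (I1 : orderType d1) (I2 : orderType d2)
    (k1 k2 : nat) (a1 : I1 -> 'I_k1 -> M) (a2 : I2 -> 'I_k2 -> M) : Prop :=
  indiscernible_over (B `|` entries a2) a1 /\
  indiscernible_over (B `|` entries a1) a2.

Definition automorphism (s : M -> M) : Prop :=
  [/\ bijective s,
      forall (f : fsymb L) (x : 'I_(farity f) -> M),
        s (finterp x) = finterp (fun i => s (x i)) &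
      forall (r : rsymb L) (x : 'I_(rarity r) -> M),
        rinterp x <-> rinterp (fun i => s (x i))].

(* The formulas use the elements of A themselves as variables. *)
Definition elementary_on (A : set M) (f : M -> M) : Prop :=
  forall phi : formula L A,
    sat (fun c : A => val c) phi <-> sat (fun c : A => f (val c)) phi.

End Semantics.

(* The cardinal kappa is represented by a type of that cardinality. *)
Definition small (kappa : Type) (X : Type) (A : set X) : Prop :=
  A #<= [set: kappa] /\ ~ ([set: kappa] #<= A).

Section Monster.
Context {L : language} (kappa : Type) (M : structure L).

Definition saturated : Prop :=
  forall (A : set M) (n : nat) (pi : set (formula L ('I_n + A))),
    small kappa A ->
    (forall F : set (formula L ('I_n + A)), F `<=` pi -> finite_set F ->
       exists v : 'I_n -> M, forall phi, F phi -> satA v phi) ->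
    exists v : 'I_n -> M, forall phi, pi phi -> satA v phi.

Definition strongly_homogeneous : Prop :=
  forall (A : set M) (f : M -> M), small kappa A -> elementary_on A f ->
    exists2 s : M -> M, automorphism s & forall c, A c -> s c = f c.

(* The cardinality of formula L nat is |T| = |L| + aleph_0. *)
Definition monster : Prop :=
  [/\ small kappa [set: formula L nat], saturated & strongly_homogeneous].

Definition type_definable (V : Type) (X : set (V -> M)) : Prop :=
  exists2 B : set M, small kappa B & type_definable_over B X.

Definition dp_minimal (n : nat) (X : set ('I_n -> M)) : Prop :=
  exists B : set M, [/\ small kappa B, type_definable_over B X &
    forall (d1 d2 : Order.disp_t) (I1 : orderType d1) (I2 : orderType d2)
      (k1 k2 : nat) (a1 : I1 -> 'I_k1 -> M) (a2 : I2 -> 'I_k2 -> M),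
      infinite_set [set: I1] -> infinite_set [set: I2] ->
      mutually_indiscernible_over B a1 a2 ->
      forall g, X g ->
        indiscernible_over (B `|` range g) a1 \/
        indiscernible_over (B `|` range g) a2].

End Monster.

Section Theories.
Context {L : language} (T : set (sentence L)).

Definition entails (phi : sentence L) : Prop :=
  forall M : structure L, models M T -> sat (of_void M) phi.

Definition complete : Prop :=
  (exists M : structure L, models M T) /\
  forall phi, entails phi \/ entails (FNot phi).

Definition NIP : Prop :=
  forall M : structure L, models M T ->
    forall (p q : nat) (phi : formula L ('I_p + 'I_q)), ~ has_IP M phi.

End Theories.

(* A group with an injection into M^n such that the image, and the image of
   the graph of multiplication, are definable with parameters. *)
Record definable_group (L : language) (M : structure L) := DefinableGroup {
  dg_group :> groupType;
  dg_arity : nat;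
  dg_emb : dg_group -> 'I_dg_arity -> M;
  dg_emb_inj : injective dg_emb;
  dg_dom_definable : definable (range dg_emb);
  dg_mul_definable :
    definable [set v | exists g h : dg_group,
                 v = join (join (dg_emb g) (dg_emb h)) (dg_emb (g * h)%g)] }.

Definition subgroup (Gt : groupType) (G : set Gt) : Prop :=
  group_closed [in G].

Definition torsion_free (Gt : groupType) (G : set Gt) : Prop :=
  forall (g : Gt) (n : nat), G g -> (0 < n)%N -> (g ^+ n = 1)%g -> g = 1%g.

Definition abelian_group (Gt : groupType) (G : set Gt) : Prop :=
  forall g h : Gt, G g -> G h -> commute g h.

(* Main.v *)
Require Import Defs.
From HB Require Import structures.
From mathcomp Require Import all_boot all_order.
From mathcomp Require Import mathcomp_extra boolp classical_sets functions cardinality.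
From mathcomp Require Import filter.

(* Dp-minimality forbids definable relations E, F and sequences x, y in G such
   that E (x_i y_j, x_i') holds iff i = i' and F (x_i y_j, y_j') iff j = j':
   replace x and y by Morley sequences of their limit types along a nonprincipal
   ultrafilter, which are mutually indiscernible, and look at g = x_0 y_0.

   In a torsion-free G this is used twice.  Let y_i range over distinct
   conjugates of g by C(g^n), with n > 0.  They have the same n-th power, so they
   do not commute with each other, and y_i, g^(n j) with E (z, u) := [z, u] = 1
   and F (z, u) := (z u^-1)^n = g^n is a forbidden pattern.  So these conjugates
   form a finite set S.  The elements of C(g^n) that centralise all that
   centralises S form a center-by-finite torsion-free group, abelian by the
   transfer; it contains S, hence S = {g} and C(g^n) = C(g).  Now if [a, b] <> 1,
   no nontrivial power of a commutes with b and conversely, and a^i, b^j is a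
   forbidden pattern for E (z, u) := [u^-1 z, b] = 1 and F (z, u) := [z u^-1, a] = 1. *)

Set Implicit Arguments.
Unset Strict Implicit.
Unset Printing Implicit Defensive.

Local Open Scope classical_set_scope.
Local Open Scope card_scope.

Lemma choice2 T U (P Q : T -> U -> Prop) :
  (forall x, exists2 y, P x y & Q x y) -> exists f, forall x, P x (f x) /\ Q x (f x).
Proof.
move=> h; have /choice[f Hf] x : exists y, P x y /\ Q x y.
  by have [y] := h x; exists y.
by exists f.
Qed.

Lemma finite_preimage T U (f : T -> U) (S : set U) :
  injective f -> finite_set S -> finite_set (f @^-1` S).
Proof.
move=> f_inj; apply: card_le_finite.
have := inj_card_eq (A := f @^-1` S) (fun x y _ _ => @f_inj x y).
move=> /card_eqPle[_ /card_le_trans]; apply; apply: subset_card_le.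
exact: image_preimage_subset.
Qed.

(** * Renaming of variables and finite support of formulas *)

Section Syntax.
Context {L : language}.

Fixpoint trename {V W : Type} (f : V -> W) (t : term L V) : term L W :=
  match t with
  | TVar x => TVar (f x)
  | TApp g args => TApp g (fun i => trename f (args i))
  end.

Fixpoint frename {V W : Type} (f : V -> W) (phi : formula L V) : formula L W :=
  match phi with
  | FEq t u => FEq (trename f t) (trename f u)
  | FRel r args => FRel r (fun i => trename f (args i))
  | FFalse => FFalse
  | FImp phi1 phi2 => FImp (frename f phi1) (frename f phi2)
  | FAll phi1 => FAll (frename (omap f) phi1)
  end.

Context (M : structure L).

Lemma teval_ren V W (f : V -> W) (w : W -> M) t :
  teval w (trename f t) = teval (w \o f) t.
Proof. by elim: t => //= g args IH; congr finterp; apply/funext => i. Qed.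

Lemma sat_ren V W (f : V -> W) (w : W -> M) phi :
  sat w (frename f phi) <-> sat (w \o f) phi.
Proof.
elim: phi W f w => {V} [V t u|V r args|V|V p IHp q IHq|V p IHp] W f w //=.
- by rewrite !teval_ren.
- suff -> : (fun i => teval w (trename f (args i))) =
            (fun i => teval (w \o f) (args i)) by [].
  by apply/funext => i; rewrite teval_ren.
- by split=> h /IHp /h /IHq.
- have e m : extend w m \o omap f = extend (w \o f) m by apply/funext => -[].
  by split=> h m; move: (h m); rewrite -?e IHp ?e.
Qed.

Lemma teval_finite_support V (t : term L V) :
  exists2 S : set V, finite_set S &
    forall v w : V -> M, {in S, v =1 w} -> teval v t = teval w t.
Proof.
elim: t => [x|g args IH] /=.
  by exists [set x]; [exact: finite_set1 | move=> v w; apply; rewrite inE].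
have {IH}[S HS] := choice2 IH.
exists (\bigcup_(i in setT) S i).
  by apply: bigcup_finite => // i _; have [] := HS i.
move=> v w vw; congr finterp; apply/funext => i; apply: (HS i).2 => x.
by rewrite inE => Sx; apply: vw; rewrite inE; exists i.
Qed.

(** Arities are finite, so only finitely many variables occur. Applied to the variables [V + A],
    this bounds the parameters that a definable set uses. *)
Lemma sat_finite_support V (phi : formula L V) :
  exists2 S : set V, finite_set S &
    forall v w : V -> M, {in S, v =1 w} -> sat v phi <-> sat w phi.
Proof.
elim: phi => {V} [V t u|V r args|V|V p [S fS IHp] q [S' fS' IHq]|V p [S fS IHp]].
- have [S fS HS] := teval_finite_support t.
  have [S' fS' HS'] := teval_finite_support u.
  exists (S `|` S'); first by rewrite finite_setU.
  move=> v w vw /=; rewrite (HS v w) ?(HS' v w) // => x; rewrite inE => xS;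
    apply: vw; rewrite inE; by [left|right].
- have [S HS] :=
    choice2 (fun i => teval_finite_support (args i)).
  exists (\bigcup_(i in setT) S i).
    by apply: bigcup_finite => // i _; have [] := HS i.
  move=> v w vw /=.
  suff -> : (fun i => teval v (args i)) = (fun i => teval w (args i)) by [].
  apply/funext => i; apply: (HS i).2 => x.
  by rewrite inE => Sx; apply: vw; rewrite inE; exists i.
- by exists set0.
- exists (S `|` S'); first by rewrite finite_setU.
  move=> v w vw /=; rewrite (IHp v w) ?(IHq v w) // => x; rewrite inE => xS;
    apply: vw; rewrite inE; by [left|right].
(* The bound variable [None] leaves the support, since [extend v m] and [extend w m] agree on it
   anyway. *)
- exists (some @^-1` S); first by apply: finite_preimage => // x y [].
  move=> v w vw /=.
  have e m : sat (extend v m) p <-> sat (extend w m) p.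
    apply: IHp => -[x|] //= xS; apply: vw; by rewrite inE in xS *.
  by split=> h m; apply/e.
Qed.

End Syntax.

Lemma finite_set_range T (A : set T) :
  finite_set A -> exists m (c : 'I_m -> T), A = range c.
Proof.
elim/Pchoice: T => T in A *; move=> /finite_seqP[s ->].
exists (size s), (tnth (in_tuple s)); apply/seteqP; split=> x /=.
  by move=> /(tnthP (in_tuple s))[i ->]; exists i.
by move=> [i _ <-]; exact: mem_tnth.
Qed.

(** * Definable sets *)

Section Definability.
Context {L : language} {M : structure L}.

(** Each coordinate of [s w] is a coordinate of [w] or a constant from [A'], so renaming turns a
    formula for [X] into one for the preimage, the constants becoming parameters. Many later
    definability claims are instances of this. *)
Lemma definable_over_subst (A A' : set M) V W (X : set (V -> M))
    (s : (W -> M) -> V -> M) :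
  A `<=` A' ->
  (forall x, (exists y, forall w, s w x = w y) \/
             (exists2 c, A' c & forall w, s w x = c)) ->
  definable_over A X -> definable_over A' (s @^-1` X).
Proof.
move=> AA' hs [phi ->].
have hg (u : V + A) : exists u' : W + A', forall w,
    join w (fun c : A' => val c) u' = join (s w) (fun c : A => val c) u.
  case: u => [x|c].
    have [[y hy]|[c A'c hc]] := hs x; first by exists (inl y) => w /=; rewrite hy.
    by exists (inr (SigSub (mem_set A'c))) => w /=; rewrite hc.
  by exists (inr (SigSub (mem_set (AA' _ (set_mem (valP c)))))).
have [g Hg] := choice hg.
exists (frename g phi); apply/seteqP; rewrite /satA; split=> w /=;
  rewrite sat_ren;
  suff -> : join w (fun c : A' => val c) \o g = join (s w) (fun c : A => val c) by [].
  by apply/funext => u; exact: Hg.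
by apply/funext => u; exact: Hg.
Qed.

Lemma definable_over_sub (A A' : set M) V (X : set (V -> M)) :
  A `<=` A' -> definable_over A X -> definable_over A' X.
Proof.
by move=> AA' /(definable_over_subst (s := id) AA'); apply=> x; left; exists x.
Qed.

Lemma definable_overC (A : set M) V (X : set (V -> M)) :
  definable_over A X -> definable_over A (~` X).
Proof. by move=> [phi ->]; exists (FNot phi). Qed.

Lemma definable_overI (A : set M) V (X Y : set (V -> M)) :
  definable_over A X -> definable_over A Y -> definable_over A (X `&` Y).
Proof.
move=> [phi ->] [psi ->]; exists (FNot (FImp phi (FNot psi))).
apply/seteqP; rewrite /satA; split=> v /=; first by move=> [? ?]; apply.
by move=> h; split; apply: contrapT => h'; apply: h => // ?.
Qed.

Lemma definable_over_ex1 (A : set M) V (X : set (option V -> M)) :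
  definable_over A X -> definable_over A [set v | exists m, X (extend v m)].
Proof.
move=> [phi ->].
pose g (u : option V + A) : option (V + A) :=
  match u with inl x => omap inl x | inr c => Some (inr c) end.
exists (FNot (FAll (FNot (frename g phi)))).
have e (v : V -> M) m : extend (join v (fun c : A => val c)) m \o g =
    join (extend v m) (fun c : A => val c).
  by apply/funext => -[[x|]|c].
apply/seteqP; rewrite /satA; split=> v /=.
  by move=> [m hm] /(_ m); apply; rewrite sat_ren e.
move=> h; apply: contrapT => h'; apply: h => m; rewrite sat_ren e => hm.
by apply: h'; exists m.
Qed.

Lemma definable_over_ex (A : set M) V n (X : set (V + 'I_n -> M)) :
  definable_over A X ->
  definable_over A [set v | exists w : 'I_n -> M, X (join v w)].
Proof.
elim: n V X => [|n IH] V X dX.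
  have i0 : 'I_0 -> M by case.
  pose s (v : V -> M) := join v i0.
  have e v w : join v w = s v by congr join; apply/funext; case.
  have -> : [set v | exists w : 'I_0 -> M, X (join v w)] = s @^-1` X.
    apply/seteqP; split=> v /=; first by move=> [w]; rewrite e.
    by move=> h; exists i0.
  by apply: definable_over_subst dX => // -[y|[]//]; left; exists y.
pose s (u : option V + 'I_n -> M) (x : V + 'I_n.+1) : M :=
  match x with
  | inl y => u (inl (Some y))
  | inr i => if unlift ord0 i is Some j then u (inr j) else u (inl None)
  end.
have dY : definable_over A (s @^-1` X).
  apply: definable_over_subst dX => // x; left.
  case: x => [y|i]; first by exists (inl (Some y)).
  rewrite /s; case: (unlift ord0 i) => [j|]; last by exists (inl None).
  by exists (inr j).
have /definable_over_ex1 := IH _ _ dY.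
suff -> : [set v | exists m, [set v0 | exists w, (s @^-1` X) (join v0 w)] (extend v m)]
  = [set v | exists w, X (join v w)] by [].
apply/seteqP; split=> v /=.
  move=> [m [w hX]].
  exists (fun i => if unlift ord0 i is Some j then w j else m).
  move: hX; congr X; apply/funext; rewrite /s => -[y|i] //=.
move=> [w hX]; exists (w ord0), (fun j => w (lift ord0 j)).
move: hX; congr X; apply/funext; rewrite /s => -[y|i] //=.
by case: (unliftP ord0 i) => [j|] ->.
Qed.

Lemma definable_over_finite (A : set M) V (X : set (V -> M)) : A !=set0 ->
  definable_over A X ->
  exists F, [/\ finite_set F, F `<=` A & definable_over F X].
Proof.
move=> [c0 Ac0] [phi ->].
have [S fS HS] := sat_finite_support M phi.
(* [c0] is the default to which [insubd] sends the parameters outside the support, on which the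
   truth of [phi] does not depend. *)
pose F := [set c0] `|` [set val c | c in [set c : A | S (inr c)]].
exists F; split.
- rewrite finite_setU; split; first exact: finite_set1.
  by apply: finite_image; apply: finite_preimage => // x y [].
- by move=> c [->//|[c' _ <-]]; exact: set_mem (valP c').
have Fc0 : c0 \in F by rewrite inE; left.
pose g (u : V + A) : V + F := match u with
  | inl x => inl x
  | inr c => inr (insubd (SigSub Fc0) (val c)) end.
exists (frename g phi); rewrite /satA; apply/seteqP; split=> v /=; rewrite sat_ren;
  apply: iffLR; [|symmetry]; apply: HS => -[x|c] //=; rewrite inE => Sc;
  rewrite val_insubd ifT // inE; right; by exists c.
Qed.

(** A definition uses finitely many parameters, and these already lie in one member of the chain. *)
Lemma definable_over_chain (D : nat -> set M) V (X : set (V -> M)) :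
  D 0 !=set0 -> {homo D : i j / (i <= j)%N >-> i `<=` j} ->
  definable_over (\bigcup_i D i) X -> exists i, definable_over (D i) X.
Proof.
move=> [c0 Dc0] mD /definable_over_finite[|F [fF FD dX]].
  by exists c0; exists 0.
suff [i Fi] : exists i, F `<=` D i.
  by exists i; exact: definable_over_sub dX.
have [m [c eF]] := finite_set_range fF; rewrite {F fF dX}eF in FD *.
have /choice[i Hi] : forall k, exists i, D i (c k).
  by move=> k; have [i _ Di] := FD (c k) (imageT _ _); exists i.
exists (\max_k i k) => _ [k _ <-]; apply: mD (Hi k); exact: leq_bigmax.
Qed.

(** Replacing the parameters from [b] by fresh variables makes it possible to vary [b]
    afterwards. *)
Lemma definable_over_absorb (A : set M) k (b : 'I_k -> M) V (X : set (V -> M)) :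
  definable_over (A `|` range b) X ->
  exists2 Y : set (V + 'I_k -> M), definable_over A Y &
    X = [set v | Y (join v b)].
Proof.
move=> [phi ->].
have hg (u : V + (A `|` range b)) : exists u' : (V + 'I_k) + A, forall v,
    join (join v b) (fun c : A => val c) u' =
    join v (fun c : (A `|` range b) => val c) u.
  case: u => [x|[c hc]]; first by exists (inl (inl x)).
  have := set_mem hc; move=> [Ac|[i _ bi]].
    by exists (inr (SigSub (mem_set Ac))).
  by exists (inl (inr i)) => v /=; rewrite bi.
have [g Hg] := choice hg.
exists [set v | satA v (frename g phi)]; first by eexists.
apply/seteqP; rewrite /satA; split=> v /=; rewrite sat_ren;
  suff -> : join (join v b) (fun c : A => val c) \o g =
    join v (fun c : (A `|` range b) => val c) by [].
  by apply/funext => u; exact: Hg.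
by apply/funext => u; exact: Hg.
Qed.

Lemma indiscernible_overP (A : set M) d (I : orderType d) k (a : I -> 'I_k -> M) :
  indiscernible_over A a <->
  forall r (i j : 'I_r -> I),
    {homo i : s t / (s < t)%N >-> (s < t)%O} ->
    {homo j : s t / (s < t)%N >-> (s < t)%O} ->
    forall X, definable_over A X ->
      X (fun x => a (i x.1) x.2) <-> X (fun x => a (j x.1) x.2).
Proof.
split=> h r i j hi hj; last first.
  by move=> phi; apply: (h r i j hi hj [set v | satA v phi]); exists phi.
by move=> _ [phi ->]; exact: h.
Qed.

End Definability.

(** * Limit types and Morley sequences *)

Lemma card_leP_inj T U (A : set T) (B : set U) (f : T -> U) :
  {homo f : x / A x >-> B x} -> {in A &, injective f} -> A #<= B.
Proof.
move=> AB fi; apply: (card_le_trans _ (subset_card_le (A := f @` A) _)).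
  by have /card_eqPle[] := inj_card_eq fi.
by move=> _ [x Ax <-]; exact: AB.
Qed.

Lemma infinite_set_injection T (S : set T) : infinite_set S ->
  exists2 y : nat -> T, (forall i, S (y i)) & injective y.
Proof.
elim/Ppointed: T => T in S *.
  by rewrite !emptyE => /(_ (finite_set0 _)).
move=> /infiniteP/pcard_leP[e]; exists e; first by move=> i; exact: funS.
by move=> i j /(inj (f := e)); apply; rewrite inE.
Qed.

Lemma infinite_setU_countable T (A C : set T) :
  infinite_set A -> countable C -> A `|` C #<= A.
Proof.
move=> /infinite_set_injection[e eA e_inj] /countable_injP[f f_inj].
have /choice[idx Hidx] x : exists n, range e x -> e n = x.
  have [[n _ <-]|] := pselect (range e x); first by exists n.
  by move=> h; exists 0 => /h.
(* As in Hilbert's hotel: [range e] moves to the even places of [e], the points of [C] outside [A]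
   go to the odd places, and the rest of [A] stays fixed. *)
pose h x := if x \in range e then e (idx x).*2
            else if x \in A then x else e (f x).*2.+1.
apply: (@card_leP_inj _ _ _ _ h) => [x _|x y].
  by rewrite /h; case: ifPn => // _; case: ifPn => //; rewrite inE.
rewrite !inE /h => ACx ACy.
have rE n : e n \in range e by rewrite inE; exists n.
have evenodd n m : n.*2 <> m.*2.+1.
  by move=> /(congr1 odd); rewrite /= !odd_double.
have [xe|xe] := boolP (x \in range e); have [ye|ye] := boolP (y \in range e).
- move/e_inj/double_inj => exy.
  by rewrite -(Hidx x (set_mem xe)) exy; apply/Hidx/set_mem.
- case: ifPn => [_ ee|_ /e_inj ee]; last by have := evenodd _ _ ee.
  by rewrite -ee rE in ye.
- case: ifPn => [_ ee|_ /e_inj/esym ee]; last by have := evenodd _ _ ee.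
  by rewrite ee rE in xe.
have [xA|xA] := boolP (x \in A); have [yA|yA] := boolP (y \in A) => //.
- by move=> ee; rewrite ee rE in xe.
- by move=> ee; rewrite -ee rE in ye.
move/e_inj => [/double_inj]; apply: f_inj; rewrite inE.
  by case: ACx => // Ax; rewrite mem_set in xA.
by case: ACy => // Ay; rewrite mem_set in yA.
Qed.

(** [kappa] exceeds the number of formulas and so is uncountable. Adding [C] does not enlarge the
    cardinality of an infinite [A], and makes a finite [A] at most countable. *)
Lemma small_setU_countable {L : language} (kappa T : Type) (A C : set T) :
  small kappa [set: formula L nat] -> countable C -> small kappa A ->
  small kappa (A `|` C).
Proof.
move=> [Lk kL] cC [Ak kA].
have natL : [set: nat] #<= [set: formula L nat].
  apply: (@card_leP_inj _ _ _ _ (fun n => FEq (TVar n) (TVar n))) => //.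
  by move=> n m _ _ [].
have [fA|iA] := pselect (finite_set A); last first.
  have AC := infinite_setU_countable iA cC.
  split; first exact: card_le_trans AC Ak.
  by move=> /card_le_trans /(_ AC).
have ACL : A `|` C #<= [set: formula L nat].
  apply: card_le_trans natL.
  rewrite -bigcup2E; apply: bigcup_countable => // -[|[|n]] _ //=.
  exact: finite_set_countable.
split; first exact: card_le_trans ACL Lk.
by move=> /card_le_trans /(_ ACL).
Qed.

(** Extending the cofinite filter gives nonprincipality, in the form that any single index may be
    ignored. *)
Lemma ultrafilter_nat : exists2 U : set_system nat, UltraFilter U &
  forall n, U [set~ n].
Proof.
have [U [uU sU]] := ultraFilterLemma eventually_filter.
exists U => // n; apply: sU; exists n.+1 => // m /=.
by move=> nm mn; rewrite mn ltnn in nm.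
Qed.

Section Average.
Context {L : language} {M : structure L} (U : set_system nat) {uU : UltraFilter U}.

(* The type over A of a is the limit along U of the types over A of the s n. *)
Definition realizes_limit (A : set M) k (s : nat -> 'I_k -> M) (a : 'I_k -> M) :=
  forall X, definable_over A X -> U (s @^-1` X) -> X a.

(** The ultrafilter contains a set or its complement, and complements of definable sets are
    definable, so the implication in [realizes_limit] reverses. *)
Lemma realizes_limitP A k (s : nat -> 'I_k -> M) a :
  realizes_limit A s a -> forall X, definable_over A X ->
  X a <-> U (s @^-1` X).
Proof.
move=> h X dX; split=> [Xa|]; last exact: h.
have [//|UC] := in_ultra_setVsetC (s @^-1` X) uU.
by have := h (~` X) (definable_overC dX) UC.
Qed.

Lemma realizes_limit_sub A A' k (s : nat -> 'I_k -> M) a :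
  A `<=` A' -> realizes_limit A' s a -> realizes_limit A s a.
Proof. by move=> AA' h X /(definable_over_sub AA'); exact: h. Qed.

Lemma realizes_limit_join A k (s : nat -> 'I_k -> M) a V (v : V -> M) :
  realizes_limit A s a -> range v `<=` A ->
  forall X : set (V + 'I_k -> M), definable_over A X ->
  X (join v a) <-> U [set n | X (join v (s n))].
Proof.
move=> h vA X dX; apply: (realizes_limitP h (X := join v @^-1` X)).
apply: definable_over_subst dX => // -[y|i]; [right|left]; last by exists i.
by exists (v y) => //; apply: vA; exists y.
Qed.

(** Finitely many formulas of the limit type hold together on a set in [U], hence at some [s n];
    saturation does the rest. *)
Lemma realizes_limit_exists kappa A k (s : nat -> 'I_k -> M) :
  saturated kappa M -> small kappa A -> exists a, realizes_limit A s a.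
Proof.
move=> sat sA.
have [|a Ha] := sat A k [set phi | U [set n | satA (s n) phi]] sA.
  move=> F FU fF.
  have [m [c eF]] := finite_set_range fF; rewrite {F fF}eF in FU *.
  have /filter_ex[n Hn] : U [set n | forall i, satA (s n) (c i)].
    by apply: filter_forall => i; apply: FU; exists i.
  by exists (s n) => _ [i _ <-].
by exists a => _ [phi ->]; exact: Ha.
Qed.

Fixpoint morley_base (A : set M) k (a : nat -> 'I_k -> M) n : set M :=
  if n is n'.+1 then morley_base A a n' `|` range (a n') else A.

(** A Morley sequence over [A] of the limit type of [s] along [U], a type finitely satisfiable in
    the terms of [s]. *)
Definition morley (A : set M) k (s a : nat -> 'I_k -> M) :=
  forall n, realizes_limit (morley_base A a n) s (a n).

Lemma morley_base_homo A k (a : nat -> 'I_k -> M) :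
  {homo morley_base A a : i j / (i <= j)%N >-> i `<=` j}.
Proof.
apply: homo_leq => [B //|B C D BC CD|n]; first exact: subset_trans CD.
by move=> c; left.
Qed.

Lemma morley_base_entries A k (a : nat -> 'I_k -> M) :
  A `|` entries a = \bigcup_n morley_base A a n.
Proof.
apply/seteqP; split=> [c [Ac|[i [x ->]]]|c [n _]].
- by exists 0.
- by exists i.+1 => //; right; exists x.
elim: n => [|n IH] /=; first by left.
by move=> [/IH//|[x _ <-]]; right; exists n, x.
Qed.

Lemma morley_exists kappa A k (s : nat -> 'I_k -> M) :
  small kappa [set: formula L nat] -> saturated kappa M -> small kappa A ->
  exists a, morley A s a.
Proof.
move=> Lk sat sA.
(* Smallness is placed under the existential so that [choice] gives a function on all sets, which
   the recursion [H] can iterate; smallness of each [H n] is checked afterwards. *)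
have ex0 B : exists a, small kappa B -> realizes_limit B s a.
  have [/(realizes_limit_exists s sat)[a Ha]|nB] := pselect (small kappa B).
    by exists a.
  by exists (s 0) => /nB.
have [F HF] := choice ex0.
pose H := fix H n := if n is n'.+1 then H n' `|` range (F (H n')) else A.
exists (fun n => F (H n)).
have eH n : morley_base A (fun n => F (H n)) n = H n by elim: n => //= n ->.
move=> n; rewrite eH; apply: HF; elim: n => [//|n IH] /=.
apply: (small_setU_countable Lk) => //.
by apply: finite_set_countable; apply: finite_image.
Qed.

(** Separates the row of index [ord_max]: along an increasing index map it is the latest term, whose
    type over the others is known. *)
Definition lift_join V k r (u : ('I_r * 'I_k) + 'I_k -> V) (x : 'I_r.+1 * 'I_k) : V :=
  if unlift ord_max x.1 is Some t then u (inl (t, x.2)) else u (inr x.2).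

(** By induction on the number of terms. The latest term realises the limit type over the earlier
    ones, so it may be replaced by [s n] for [U]-almost all [n]; as [s n] lies in [A], the induction
    hypothesis compares the remaining terms. *)
Lemma morley_indiscernible A k (s a : nat -> 'I_k -> M) :
  entries s `<=` A -> morley A s a -> indiscernible_over A a.
Proof.
move=> sA Ha; apply/indiscernible_overP => r i j hi hj X dX.
elim: r i j hi hj X dX => [|r IH] i j hi hj X dX.
  suff -> : (fun x : 'I_0 * 'I_k => a (i x.1) x.2) = (fun x => a (j x.1) x.2) by [].
  by apply/funext => -[[]].
have limX (h : 'I_r.+1 -> nat) :
    {homo h : s t / (s < t)%N >-> (s < t)%O} ->
    X (fun x => a (h x.1) x.2) <->
    U [set n | X (lift_join (join
       (fun x : 'I_r * 'I_k => a (h (lift ord_max x.1)) x.2) (s n)))].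
  move=> hh.
  have -> : (fun x => a (h x.1) x.2) = lift_join (join
       (fun x : 'I_r * 'I_k => a (h (lift ord_max x.1)) x.2) (a (h ord_max))).
    by apply/funext => -[x y]; rewrite /lift_join /=; case: unliftP => [t|] ->.
  apply: (realizes_limit_join (Ha (h ord_max)) _ (X := @lift_join M k r @^-1` X)).
    move=> _ [[x y] _ <-] /=.
    apply: (@morley_base_homo A k a (h (lift ord_max x)).+1) => /=.
      by apply: hh; rewrite lift_max; exact: ltn_ord.
    by right; exists y.
  apply: definable_over_subst dX; first exact: (@morley_base_homo A k a 0).
  move=> [x y]; left; rewrite /lift_join.
  by case: (unlift ord_max x) => [t|]; eexists.
rewrite !limX //; suff e n : X (lift_join (join
      (fun x : 'I_r * 'I_k => a (i (lift ord_max x.1)) x.2) (s n))) <->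
    X (lift_join (join
      (fun x : 'I_r * 'I_k => a (j (lift ord_max x.1)) x.2) (s n))).
  by split; apply: filterS => n /e.
apply: (IH (i \o lift ord_max) (j \o lift ord_max) _ _
  ((fun u => lift_join (join u (s n))) @^-1` X)).
- by move=> x y xy; apply: hi; rewrite !lift_max.
- by move=> x y xy; apply: hj; rewrite !lift_max.
apply: definable_over_subst dX => // -[x y]; rewrite /lift_join /=.
case: (unlift ord_max x) => [t|]; first by left; exists (t, y).
by right; exists (s n y) => //; apply: sA; exists n, y.
Qed.

(* The limit type of [t] is invariant over [A], so the tuples of [a] that have
   the same type over [A] still have the same type after adjoining [b]. *)
Lemma indiscernible_over_morley A k l (a : nat -> 'I_k -> M) (t b : nat -> 'I_l -> M) :
  A !=set0 -> entries t `<=` A -> indiscernible_over A a ->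
  morley (A `|` entries a) t b -> indiscernible_over (A `|` entries b) a.
Proof.
move=> A0 tA /indiscernible_overP ia Hb; apply/indiscernible_overP => r i j hi hj X.
(* Only finitely many terms of [b] are involved; they are removed one at a time, the latest
   first. *)
rewrite morley_base_entries => /definable_over_chain[||n dX] //.
  exact: morley_base_homo.
elim: n X dX => [|n IH] X; first exact: ia.
move=> /definable_over_absorb[Y dY ->] /=.
have limY (h : 'I_r -> nat) : Y (join (fun x => a (h x.1) x.2) (b n)) <->
    U [set m | Y (join (fun x => a (h x.1) x.2) (t m))].
  apply: (realizes_limit_join (Hb n)).
    move=> _ [x _ <-]; apply: (@morley_base_homo _ _ b 0) => //.
    by right; exists (h x.1), x.2.
  apply: definable_over_sub dY; elim: (n) => [|m IHm] /=; first by move=> c; left.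
  by move=> c [/IHm|]; [left|right].
rewrite !limY; suff e m : Y (join (fun x => a (i x.1) x.2) (t m)) <->
    Y (join (fun x => a (j x.1) x.2) (t m)).
  by split; apply: filterS => m /e.
apply: (IH ((fun u => join u (t m)) @^-1` Y)).
apply: definable_over_subst dY => // -[x|x]; first by left; exists x.
right; exists (t m x) => //; apply: (@morley_base_homo _ _ b 0) => //.
by apply: tA; exists m, x.
Qed.

(** Building [b] over [A] together with [a] makes [b] indiscernible over [a]; the converse is
    [indiscernible_over_morley]. *)
Lemma morley_mutually_indiscernible kappa A k l
    (s : nat -> 'I_k -> M) (t : nat -> 'I_l -> M) :
  small kappa [set: formula L nat] -> saturated kappa M -> small kappa A ->
  A !=set0 -> entries s `<=` A -> entries t `<=` A ->
  exists a b, [/\ morley A s a, morley (A `|` entries a) t b &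
    mutually_indiscernible_over A a b].
Proof.
move=> Lk sat sA A0 As At.
have [a Ha] := morley_exists s Lk sat sA.
have sAa : small kappa (A `|` entries a).
  apply: (small_setU_countable Lk) => //.
  have -> : entries a = \bigcup_i range (a i).
    by apply/seteqP; split=> [c [i [x ->]]|c [i _ [x _ <-]]]; exists i => //; exists x.
  apply: bigcup_countable => // i _.
  by apply: finite_set_countable; apply: finite_image.
have [b Hb] := morley_exists t Lk sat sAa.
exists a, b; split=> //; split.
  exact: indiscernible_over_morley (morley_indiscernible As Ha) Hb.
by apply: (morley_indiscernible _ Hb) => c /At; left.
Qed.

End Average.

(** * Relations on a definable group *)

Section GroupDefinability.
Context {L : language} {M : structure L} (Gt : definable_group M).
Local Notation emb := (@dg_emb L M Gt).
Local Notation n := (dg_arity Gt).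
Implicit Types (A : set M) (I J : Type).

Definition emb_family I (v : I -> Gt) (x : I * 'I_n) : M := emb (v x.1) x.2.

(** Only the trace of [X] on tuples from the group matters, so Boolean operations are immediate,
    while quantifiers have to be restricted to [range emb]. *)
Definition gdefinable A I (R : set (I -> Gt)) :=
  exists2 X, definable_over A X & R = @emb_family I @^-1` X.

Definition extend_group I (v : I -> Gt) (g : Gt) (x : option I) : Gt :=
  if x is Some y then v y else g.

Definition defines_group A :=
  definable_over A (range emb) /\
  definable_over A [set v | exists g h : Gt,
                 v = join (join (emb g) (emb h)) (emb (g * h)%g)].

Lemma defines_group_finite :
  exists2 A : set M, finite_set A & forall A', A `<=` A' -> defines_group A'.
Proof.
have [c] := carrier_inhabited M.
have T0 : [set: M] !=set0 by exists c.
have [A1 [f1 _ d1]] := definable_over_finite T0 (dg_dom_definable Gt).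
have [A2 [f2 _ d2]] := definable_over_finite T0 (dg_mul_definable Gt).
exists (A1 `|` A2); first by rewrite finite_setU.
by move=> A' sA; split; [apply: definable_over_sub d1|apply: definable_over_sub d2];
  move=> x Ax; apply: sA; [left|right].
Qed.

Lemma gdefinable_subst A A' I J (R : set (I -> Gt)) (s : (J -> Gt) -> I -> Gt) :
  A `<=` A' ->
  (forall x, (exists y, forall w, s w x = w y) \/
             (exists2 c, range (emb c) `<=` A' & forall w, s w x = c)) ->
  gdefinable A R -> gdefinable A' (s @^-1` R).
Proof.
move=> AA' hs [X dX ->].
have /choice[f Hf] x : exists f : (J * 'I_n -> M) -> 'I_n -> M,
    (forall i, (exists y, forall w, f w i = w y) \/
               (exists2 c, A' c & forall w, f w i = c)) /\
    forall w, f (emb_family w) = emb (s w x).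
  have [[y sy]|[c cA sc]] := hs x.
    exists (fun w i => w (y, i)); split=> [i|w]; first by left; exists (y, i).
    by apply/funext => i; rewrite sy.
  exists (fun=> emb c); split=> [i|w]; last by rewrite sc.
  by right; exists (emb c i) => //; apply: cA; exists i.
exists ((fun w (x : I * 'I_n) => f x.1 w x.2) @^-1` X).
  by apply: definable_over_subst dX => // -[x i] /=; exact: (Hf x).1.
suff e w : emb_family (s w) = (fun x : I * 'I_n => f x.1 (emb_family w) x.2).
  by apply/seteqP; split=> w /=; rewrite e.
by apply/funext => -[x i]; rewrite (Hf x).2.
Qed.

Lemma gdefinable_sub A A' I (R : set (I -> Gt)) :
  A `<=` A' -> gdefinable A R -> gdefinable A' R.
Proof.
by move=> AA' /(gdefinable_subst (s := id) AA'); apply=> x; left; exists x.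
Qed.

Lemma gdefinableC A I (R : set (I -> Gt)) : gdefinable A R -> gdefinable A (~` R).
Proof. by move=> [X dX ->]; exists (~` X) => //; exact: definable_overC. Qed.

Lemma gdefinableI A I (R S : set (I -> Gt)) :
  gdefinable A R -> gdefinable A S -> gdefinable A (R `&` S).
Proof.
by move=> [X dX ->] [Y dY ->]; exists (X `&` Y) => //; exact: definable_overI.
Qed.

Lemma gdefinable_ex A I (R : set (option I -> Gt)) :
  defines_group A -> gdefinable A R ->
  gdefinable A [set v | exists g, R (extend_group v g)].
Proof.
move=> [dG _] [X dX ->].
pose s (u : (I * 'I_n) + 'I_n -> M) (x : option I * 'I_n) : M :=
  if x.1 is Some y then u (inl (y, x.2)) else u (inr x.2).
exists [set v | exists w : 'I_n -> M,
    (s @^-1` X `&` (fun (u : (I * 'I_n) + 'I_n -> M) i => u (inr i)) @^-1` (range emb))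
      (join v w)].
  apply: definable_over_ex; apply: definable_overI.
    apply: definable_over_subst dX => // -[[x|] i]; left; by eexists.
  by apply: definable_over_subst dG => // i; left; exists (inr i).
have e v g : emb_family (extend_group v g) = s (join (emb_family v) (emb g)).
  by apply/funext => -[[x|] i].
apply/seteqP; split=> v /=.
  by move=> [g]; rewrite e => Xg; exists (emb g); split=> //; exists g.
by move=> [w [Xw [g _ gw]]]; exists g; rewrite e gw.
Qed.

Lemma gdefinable_mul A I (i j k : I) :
  defines_group A -> gdefinable A [set v : I -> Gt | (v i * v j = v k)%g].
Proof.
move=> [_ dm].
pose s (u : I * 'I_n -> M) : ('I_n + 'I_n) + 'I_n -> M :=
  join (join (fun x => u (i, x)) (fun x => u (j, x))) (fun x => u (k, x)).
exists (s @^-1` [set v | exists g h : Gt,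
                 v = join (join (emb g) (emb h)) (emb (g * h)%g)]).
  by apply: definable_over_subst dm => // -[[x|x]|x]; left; by eexists.
have join_inj V W (v v' : V -> M) (w w' : W -> M) :
    join v w = join v' w' -> v = v' /\ w = w'.
  move=> /funeqP e; split; apply/funext => x.
    exact: (e (inl x)).
  exact: (e (inr x)).
apply/seteqP; split=> v /=; first by move=> e; exists (v i), (v j); rewrite e.
move=> [g [h /join_inj[/join_inj[]]]].
have injE k' g' : (fun x => emb_family v (k', x)) = emb g' -> v k' = g'.
  exact: (@dg_emb_inj _ _ Gt (v k') g').
by move=> /injE -> /injE -> /injE ->.
Qed.

(** Equality is read off from the graph of multiplication, as [v i * 1 = v j]. *)
Lemma gdefinable_eq A I (i j : I) : defines_group A ->
  range (emb 1%g) `<=` A -> gdefinable A [set v : I -> Gt | v i = v j].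
Proof.
move=> dA A1.
have := gdefinable_mul (Some i) None (Some j) dA.
move=> /(gdefinable_subst (s := fun v => extend_group v 1%g) (fun x h => h)) h.
have -> : [set v : I -> Gt | v i = v j] = (fun v => extend_group v 1%g) @^-1`
    [set v | (v (Some i) * v None)%g = v (Some j)].
  by apply/seteqP; split=> v /=; rewrite mulg1.
by apply: h => -[x|]; [left; exists x|right; exists 1%g].
Qed.

(* The definable maps, as those that can be substituted for a variable in every
   definable relation. *)
Definition gfun A I (f : (I -> Gt) -> Gt) :=
  forall J (R : set (option J -> Gt)) (e : I -> J), gdefinable A R ->
  gdefinable A [set v : J -> Gt | R (extend_group v (f (v \o e)))].

Lemma gfun_var A I (i : I) : gfun A (fun v => v i).
Proof.
move=> J R e /(gdefinable_subst (s := fun v : J -> Gt => extend_group v (v (e i)))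
  (fun x h => h)); apply.
by move=> [x|]; left; [exists x|exists (e i)].
Qed.

Lemma gfun_const A I (c : Gt) : range (emb c) `<=` A -> gfun A (fun _ : I -> Gt => c).
Proof.
move=> cA J R e /(gdefinable_subst (s := fun v : J -> Gt => extend_group v c)
  (fun x h => h)); apply.
by move=> [x|]; [left; exists x|right; exists c].
Qed.

Lemma gfun_eq A I (f g : (I -> Gt) -> Gt) : defines_group A ->
  range (emb 1%g) `<=` A ->
  gfun A f -> gfun A g -> gdefinable A [set v | f v = g v].
Proof.
move=> dA A1 df dg.
have deq := gdefinable_eq (Some None) (None : option (option I)) dA A1.
exact: (df _ _ id (dg _ _ Some deq)).
Qed.

(** [R] holds at the product iff some [p] equals the product and satisfies [R]. In the nested
    [option], [Some (Some None)] and [Some None] stand for the two factors and [None] for [p]. *)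
Lemma gfun_mul A I (f g : (I -> Gt) -> Gt) : defines_group A ->
  gfun A f -> gfun A g -> gfun A (fun v => (f v * g v)%g).
Proof.
move=> dA df dg J R e dR.
pose s (u : option (option (option J)) -> Gt) (x : option J) : Gt :=
  if x is Some y then u (Some (Some (Some y))) else u None.
have dR' : gdefinable A (s @^-1` R).
  apply: gdefinable_subst dR => // -[y|]; left; by eexists.
have dm := gdefinable_mul (Some (Some (None : option J))) (Some None) None dA.
have := df _ _ e (dg _ _ (Some \o e) (gdefinable_ex dA (gdefinableI dm dR'))).
congr gdefinable; apply/seteqP; split=> v /=.
  move=> [p [<-]]; congr R; apply/funext => -[y|] //=.
move=> h; eexists; split; first reflexivity.
by move: h; congr R; apply/funext => -[y|].
Qed.

Lemma gfun_inv A I (f : (I -> Gt) -> Gt) : defines_group A ->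
  range (emb 1%g) `<=` A -> gfun A f -> gfun A (fun v => (f v)^-1%g).
Proof.
move=> dA A1 df J R e dR.
pose s (u : option (option J) -> Gt) (x : option J) : Gt :=
  if x is Some y then u (Some (Some y)) else u None.
have dR' : gdefinable A (s @^-1` R).
  apply: gdefinable_subst dR => // -[y|]; left; by eexists.
have dm : gdefinable A [set u : option (option J) -> Gt |
    (u (Some None) * u None = 1)%g].
  apply: gfun_eq => //; last exact: (@gfun_const A _ 1%g A1).
  by apply: gfun_mul => //; exact: gfun_var.
have := df _ _ e (gdefinable_ex dA (gdefinableI dm dR')).
congr gdefinable; apply/seteqP; split=> v /=.
  by move=> [p [/mulg1_eq <-]]; congr R; apply/funext => -[y|].
move=> h; eexists; split; first exact: mulgV.
by move: h; congr R; apply/funext => -[y|].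
Qed.

Lemma gfun_exp A I (f : (I -> Gt) -> Gt) m : defines_group A ->
  range (emb 1%g) `<=` A -> gfun A f -> gfun A (fun v => (f v ^+ m)%g).
Proof.
move=> dA A1 df; elim: m => [|m IH]; first exact: (@gfun_const A I 1%g A1).
have -> : (fun v => f v ^+ m.+1)%g = (fun v => f v * f v ^+ m)%g.
  by apply/funext => v; rewrite expgS.
exact: gfun_mul.
Qed.

Definition gdefinable2 A (E : Gt -> Gt -> Prop) :=
  gdefinable A [set v : bool -> Gt | E (v true) (v false)].

Definition gdefinable3 A (T : Gt -> Gt -> Gt -> Prop) :=
  gdefinable A
    [set v : option bool -> Gt | T (v (Some true)) (v (Some false)) (v None)].

Lemma gdefinable2_comp A E I (f g : (I -> Gt) -> Gt) :
  gfun A f -> gfun A g -> gdefinable2 A E -> gdefinable A [set v | E (f v) (g v)].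
Proof.
move=> df dg dE.
have dE' : gdefinable A [set u : option (option I) -> Gt | E (u (Some None)) (u None)].
  pose s (u : option (option I) -> Gt) (b : bool) :=
    if b then u (Some None) else u None.
  by apply: (gdefinable_subst (s := s) _ _ dE) => // -[]; left; by eexists.
exact: (df _ _ id (dg _ _ Some dE')).
Qed.

(** What [realizes_limit] says about ternary relations with two group elements as parameters: the
    form in which iterated limits are evaluated in [dp_minimal_pattern]. *)
Definition limit_point (U : set_system nat) A (x : nat -> Gt) (g : Gt) :=
  forall T p q, gdefinable3 A T -> range (emb p) `<=` A -> range (emb q) `<=` A ->
  U [set k | T p q (x k)] -> T p q g.

(* Dp-minimality only allows parameters from its own set B, so the parameters of
   the relations are carried along as constant coordinates of the tuples. *)
Definition append_params m (c : 'I_m -> M) (g : Gt) (i : 'I_(n + m)) : M :=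
  match fintype.split i with inl j => emb g j | inr j => c j end.

Lemma append_lshift m (c : 'I_m -> M) g i : append_params c g (lshift m i) = emb g i.
Proof. by rewrite /append_params (unsplitK (inl i)). Qed.

Lemma append_rshift m (c : 'I_m -> M) g i : append_params c g (rshift n i) = c i.
Proof. by rewrite /append_params (unsplitK (inr i)). Qed.

(** Lying in [range emb] and having the last coordinates equal to [c] are conditions definable over
    [A]; they hold along the whole sequence, hence in the limit. *)
Lemma realizes_limit_append U {uU : UltraFilter U} A m (c : 'I_m -> M) x a :
  defines_group A -> range c `<=` A ->
  realizes_limit U A (fun k => append_params c (x k)) a ->
  exists2 g, a = append_params c g & limit_point U A x g.
Proof.
move=> [dG _] cA lim_a.
have Uall (P : set nat) : (forall k, P k) -> U P.
  by move=> Pk; apply: filterS filterT.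
have [g _ ag] : range emb (fun i => a (lshift m i)).
  apply: (lim_a ((fun (u : 'I_(n + m) -> M) i => u (lshift m i)) @^-1` range emb)).
    by apply: definable_over_subst dG => // i; left; exists (lshift m i).
  apply: Uall => k; exists (x k) => //.
  by apply/funext => i; rewrite append_lshift.
have ac i : a (rshift n i) = c i.
  apply: (lim_a [set u | u (rshift n i) = c i]).
    have := cA _ (imageT c i) => Ac.
    exists (FEq (TVar (inl (rshift n i))) (TVar (inr (SigSub (mem_set Ac))))).
    by [].
  by apply: Uall => k /=; rewrite append_rshift.
have ea : a = append_params c g.
  apply/funext => i; rewrite -(splitK i); case: (fintype.split i) => j /=.
    by rewrite append_lshift ag.
  by rewrite append_rshift ac.
exists g => // T p q [X dX eX] pA qA UT.
pose v (b : bool) := if b then p else q.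
pose s (u : (bool * 'I_n) + 'I_(n + m) -> M) (y : option bool * 'I_n) : M :=
  if y.1 is Some b then u (inl (b, y.2)) else u (inr (lshift m y.2)).
have eT h : T p q h <-> (s @^-1` X) (join (emb_family v) (append_params c h)).
  have -> : T p q h = ([set v : option bool -> Gt |
      T (v (Some true)) (v (Some false)) (v None)] (extend_group v h)) by [].
  rewrite eX /=; suff -> : emb_family (extend_group v h) =
    s (join (emb_family v) (append_params c h)) by [].
  by apply/funext => -[[b|] i] //; rewrite /s /= append_lshift.
apply/eT; rewrite -ea; apply/(realizes_limit_join lim_a).
- by move=> _ [[[] i] _ <-]; [apply: pA; exists i|apply: qA; exists i].
- by apply: definable_over_subst dX => // -[[b|] i]; left; by eexists.
by apply: filterS UT => k /eT.
Qed.

(** The parameters of [E] are coordinates of [a 0] and [a 1] themselves, so [E z] is a condition on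
    one term of [a] with parameters from [z] only, and the one-term subsequences at 0 and 1 agree on
    it. *)
Lemma indiscernible_append A m (c : 'I_m -> M) (a : nat -> 'I_(n + m) -> M)
    (E : Gt -> Gt -> Prop) z g h :
  gdefinable2 (range c) E -> a 0 = append_params c g -> a 1 = append_params c h ->
  indiscernible_over (A `|` range (emb z)) a -> E z g -> E z h.
Proof.
move=> [X dX eX] a0 a1 /indiscernible_overP ia.
have /definable_over_absorb[Y dY eXY] : definable_over (set0 `|` range c) X.
  by rewrite set0U.
pose s (u : 'I_1 * 'I_(n + m) -> M) (y : (bool * 'I_n) + 'I_m) : M :=
  match y with
  | inl (b, i) => if b then emb z i else u (ord0, lshift m i)
  | inr i => u (ord0, rshift n i)
  end.
have eE k g' : a k = append_params c g' -> E z g' <-> (s @^-1` Y) (fun x => a k x.2).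
  move=> ak; pose v (b : bool) := if b then z else g'.
  have -> : E z g' = ([set v : bool -> Gt | E (v true) (v false)] v) by [].
  rewrite eX eXY /=; suff -> : join (emb_family v) c = s (fun x => a k x.2) by [].
  apply/funext => -[[[] i]|i] //=; rewrite ak ?append_lshift ?append_rshift //.
move=> /(eE _ _ a0) h0; apply/(eE _ _ a1); move: h0.
have := ia 1 (fun=> 0) (fun=> 1) _ _ (s @^-1` Y).
case=> [|||h1 _ /h1//]; first by move=> x y; rewrite !ord1 ltnn.
  by move=> x y; rewrite !ord1 ltnn.
apply: definable_over_subst dY => // -[[[] i]|i]; rewrite /s.
- by right; exists (emb z i) => //; right; exists i.
- by left; exists (ord0, lshift m i).
- by left; exists (ord0, rshift n i).
Qed.

End GroupDefinability.

(** * Subgroups given as sets, and powers in torsion-free subgroups *)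

Section Subgroups.
Context (H : groupType) (P : set H) (P_subgroup : subgroup P).

Lemma subgroup1 : P 1%g.
Proof. exact/set_mem/P_subgroup.1. Qed.

Lemma subgroupF g h : P g -> P h -> P (g / h)%g.
Proof. by move=> /mem_set Pg /mem_set Ph; apply/set_mem/P_subgroup.2. Qed.

Lemma subgroupV g : P g -> P (g^-1)%g.
Proof. by move=> /(subgroupF subgroup1); rewrite mul1g. Qed.

Lemma subgroupM g h : P g -> P h -> P (g * h)%g.
Proof. by move=> Pg /subgroupV /(subgroupF Pg); rewrite invgK. Qed.

Lemma subgroupX g n : P g -> P (g ^+ n)%g.
Proof.
move=> Pg; elim: n => [|n IH]; first exact: subgroup1.
by rewrite expgS; exact: subgroupM.
Qed.

Hypothesis P_torsion_free : torsion_free P.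

Lemma torsion_free_expg_inj g h n : P g -> P h -> commute g h -> (0 < n)%N ->
  (g ^+ n = h ^+ n)%g -> g = h.
Proof.
move=> Pg Ph cgh n0 e; apply: divg1_eq.
apply: (P_torsion_free _ n0); first exact: subgroupF.
by rewrite expgnFl // e mulgV.
Qed.

Lemma torsion_free_expgI g : P g -> g <> 1%g -> injective (fun n => g ^+ n)%g.
Proof.
move=> Pg g1.
have lt_ne i j : (i < j)%N -> (g ^+ i <> g ^+ j)%g.
  move=> ij e; apply: g1; apply: (P_torsion_free Pg (n := j - i)).
    by rewrite subn_gt0.
  by rewrite expgnFr ?(ltnW ij) // e mulgV.
move=> i j /= e; case: (ltngtP i j) => // /lt_ne; first by move=> /(_ e).
by move=> /(_ (esym e)).
Qed.

End Subgroups.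

(** * The pattern forbidden by dp-minimality *)

Section Pattern.
Context {L : language} (kappa : Type) (M : structure L) (Gt : definable_group M).
Context (G : set Gt).
Hypothesis small_language : small kappa [set: formula L nat].
Hypothesis M_saturated : saturated kappa M.
Hypothesis G_subgroup : subgroup G.
Hypothesis G_dp_minimal : dp_minimal kappa [set dg_emb g | g in G].
Local Notation emb := (@dg_emb L M Gt).

(** In the limit, [g0 * h0] is [E]-related to [g0] but not to [g1], and [F]-related to [h0] but not
    to [h1]. So neither of the mutually indiscernible sequences through these elements stays
    indiscernible over [g0 * h0]. *)
Lemma dp_minimal_pattern A0 (E F : Gt -> Gt -> Prop) (x y : nat -> Gt) :
  finite_set A0 -> gdefinable2 A0 E -> gdefinable2 A0 F ->
  (forall i, G (x i)) -> (forall j, G (y j)) ->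
  (forall i j, E (x i * y j)%g (x i)) ->
  (forall i i' j, i <> i' -> ~ E (x i * y j)%g (x i')) ->
  (forall i j, F (x i * y j)%g (y j)) ->
  (forall i j j', j <> j' -> ~ F (x i * y j)%g (y j')) -> False.
Proof.
move=> fA0 dE dF Gx Gy Ex nEx Fy nFy.
have [U uU Un] := ultrafilter_nat.
have [c0] := carrier_inhabited M.
have [A1 fA1 dA1] := defines_group_finite Gt.
have [B [sB [pi epi] dpB]] := G_dp_minimal.
(* [c] lists the parameters of [E], of [F] and of the group; [c0] ensures that [A] is nonempty. *)
have [m [c ec]] : exists m (c : 'I_m -> M), A0 `|` A1 `|` [set c0] = range c.
  by apply: finite_set_range; rewrite !finite_setU; do 2?split=> //; exact: finite_set1.
(* [C] is countable, so [A] stays small; it contains the terms of both sequences, as the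
   indiscernibility of Morley sequences requires. *)
pose C := range c `|` (\bigcup_i range (emb (x i)) `|` \bigcup_j range (emb (y j))).
pose A := B `|` C.
have sA : small kappa A.
  apply: (small_setU_countable small_language) => //.
  rewrite /C -!bigcup2E; apply: bigcup_countable => // -[|[|k]] _ //=.
    by apply: finite_set_countable; exact: finite_image.
  apply: bigcup_countable => // -[|[|k']] _ //=; apply: bigcup_countable => // i _;
    by apply: finite_set_countable; exact: finite_image.
have cA : range c `<=` A by move=> d ?; right; left.
have A01 : A0 `<=` A by move=> d ?; apply: cA; rewrite -ec; left; left.
have dA : defines_group Gt A.
  by apply: dA1 => d ?; apply: cA; rewrite -ec; left; right.
have xA i : range (emb (x i)) `<=` A by move=> d ?; right; right; left; exists i.
have yA j : range (emb (y j)) `<=` A by move=> d ?; right; right; right; exists j.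
have appA z : range (emb z) `<=` A -> range (append_params c z) `<=` A.
  move=> zA _ [i _ <-]; rewrite /append_params; case: (fintype.split i) => j.
    by apply: zA; exists j.
  by apply: cA; exists j.
have [|||a [b [ma mb [mia mib]]]] := @morley_mutually_indiscernible _ _ U uU kappa A _ _
  (fun k => append_params c (x k)) (fun k => append_params c (y k))
  small_language M_saturated sA.
- by exists c0; apply: cA; rewrite -ec; right.
- by move=> _ [k [i ->]]; apply: (appA _ (xA k)); exists i.
- by move=> _ [k [i ->]]; apply: (appA _ (yA k)); exists i.
(* [G] is cut out by formulas over [B], each true along the whole sequence and so true in the
   limit. *)
have inG (z : nat -> Gt) g : (forall k, G (z k)) ->
    realizes_limit U A (fun k => append_params c (z k)) (append_params c g) -> G g.
  move=> Gz lim; suff [g' Gg' /dg_emb_inj <-] : [set emb g | g in G] (emb g) by [].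
  rewrite epi => phi piphi; pose s (u : 'I_(dg_arity Gt + m) -> M) i := u (lshift m i).
  have es g' : s (append_params c g') = emb g'.
    by apply/funext => i; exact: append_lshift.
  rewrite -es; apply: (lim (s @^-1` [set v | satA v phi])).
    apply: (@definable_over_subst _ _ B); first by move=> d ?; left.
      by move=> i; left; exists (lshift m i).
    by exists phi.
  apply: filterS filterT => k _ /=; rewrite es.
  have : [set emb g | g in G] (emb (z k)) by exists (z k).
  by rewrite epi; exact.
have appr z : range (emb z) `<=` range (append_params c z).
  by move=> _ [i _ <-]; exists (lshift m i) => //; rewrite append_lshift.
have dA' A' : A `<=` A' -> defines_group Gt A' /\ range c `<=` A'.
  move=> AA'; split; last exact: subset_trans AA'.
  by apply: dA1 => d ?; apply/AA'/cA; rewrite -ec; left; right.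
have subA : A `<=` A by [].
have sub1 : A `<=` morley_base A a 1 by move=> d ?; left.
have sub2 : A `<=` A `|` entries a by move=> d ?; left.
have sub3 : A `<=` morley_base (A `|` entries a) b 1 by move=> d ?; left; left.
(* Each of [g0], [g1], [h0], [h1] is a limit over a set containing the coordinates of the preceding
   ones, so limits are unfolded from the last element to the first. *)
have [g0 ag0 lg0] := realizes_limit_append dA cA (ma 0).
have [g1 ag1 lg1] := realizes_limit_append (dA' _ sub1).1 (dA' _ sub1).2 (ma 1).
have [h0 bh0 lh0] := realizes_limit_append (dA' _ sub2).1 (dA' _ sub2).2 (mb 0).
have [h1 bh1 lh1] := realizes_limit_append (dA' _ sub3).1 (dA' _ sub3).2 (mb 1).
have Gg0 : G g0 by apply: (inG x) => //; rewrite -ag0; exact: (ma 0).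
have Gh0 : G h0.
  by apply: (inG y) => //; rewrite -bh0; apply: realizes_limit_sub (mb 0).
have g01 : range (emb g0) `<=` morley_base A a 1.
  by move=> d /appr; rewrite -ag0 => ?; right.
have ga k z : a k = append_params c z -> range (emb z) `<=` A `|` entries a.
  by move=> ak d /appr; rewrite -ak => -[i _ <-]; right; exists k, i.
have h03 : range (emb h0) `<=` morley_base (A `|` entries a) b 1.
  by move=> d /appr; rewrite -bh0 => ?; right.
have d3 R A' (f g : (option bool -> Gt) -> Gt) : gdefinable2 A0 R -> A `<=` A' ->
    gfun A' f -> gfun A' g -> gdefinable A' [set v | R (f v) (g v)].
  move=> dR AA' df dg; apply: gdefinable2_comp df dg _.
  by apply: gdefinable_sub dR => d /A01/AA'.
have infn : infinite_set [set: nat] := infinite_nat.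
have Be S : B `|` S `<=` A `|` S by move=> d [?|?]; [left; left|right].
have mB : mutually_indiscernible_over B a b.
  by split; [move: mia|move: mib]; rewrite !indiscernible_overP => h r i j hi hj X dX;
    apply: (h r i j hi hj X); apply: definable_over_sub dX; exact: Be.
have Gz : [set emb g | g in G] (emb (g0 * h0)%g).
  by exists (g0 * h0)%g => //; exact: (subgroupM G_subgroup).
have var I A' (i : I) : gfun A' (fun v : I -> Gt => v i) by exact: gfun_var.
have mul I A' (i j : I) : A `<=` A' -> gfun A' (fun v : I -> Gt => v i * v j)%g.
  by move=> AA'; apply: gfun_mul; [exact: (dA' _ AA').1|exact: var|exact: var].
have Utrue (P : set nat) : (forall k, P k) -> U P by move=> Pk; apply: filterS filterT.
have Uneq (P : set nat) k : (forall i, i <> k -> P i) -> U P.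
  by move=> Pk; apply: filterS (Un k) => i /Pk.
have cR (R : Gt -> Gt -> Prop) : gdefinable2 A0 R -> gdefinable2 (range c) R.
  by apply: gdefinable_sub => d ?; rewrite -ec; left; left.
have ga0 := ga _ _ ag0; have ga1 := ga _ _ ag1.
have [ia|ib] := dpB _ _ nat nat _ _ a b infn infn mB _ Gz.
  have EE := indiscernible_append (cR _ dE) ag0 ag1 ia.
  (* Replace [h0] by [y j], then [g1] by [x i'], then [g0] by [x i]; nonprincipality of [U] allows
     [i <> i']. *)
  have : ~ E (g0 * h0)%g g1.
    apply: (lh0 (fun p q r => ~ E (p * r)%g q)) => //.
      exact: (gdefinableC (d3 _ _ _ _ dE sub2
        (mul _ _ (Some true) None sub2) (var _ _ (Some false)))).
    apply: (Utrue _) => j /=.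
    apply: (lg1 (fun p q r => ~ E (p * q)%g r)) => //.
    + exact: (gdefinableC (d3 _ _ _ _ dE sub1
        (mul _ _ (Some true) (Some false) sub1) (var _ _ None))).
    + exact: subset_trans (yA j) _.
    apply: (Utrue _) => i' /=.
    apply: (lg0 (fun p q r => ~ E (r * p)%g q)) => //.
      exact: (gdefinableC (d3 _ _ _ _ dE subA
        (mul _ _ None (Some true) subA) (var _ _ (Some false)))).
    by apply: (Uneq _ i') => i ii'; apply: nEx.
  apply; apply: EE.
  apply: (lh0 (fun p q r => E (p * r)%g p) g0 g0) => //.
    exact: (d3 _ _ _ _ dE sub2
        (mul _ _ (Some true) None sub2) (var _ _ (Some true))).
  apply: (Utrue _) => j /=.
  apply: (lg0 (fun p q r => E (r * p)%g r) (y j) (y j)) => //.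
    exact: (d3 _ _ _ _ dE subA
        (mul _ _ None (Some true) subA) (var _ _ None)).
  by apply: (Utrue _) => i /=; apply: Ex.
have FF := indiscernible_append (cR _ dF) bh0 bh1 ib.
(* Replace [h1] by [y j'], then [h0] by [y j] with [j <> j'], then [g0] by [x i]. *)
have : ~ F (g0 * h0)%g h1.
  apply: (lh1 (fun p q r => ~ F (p * q)%g r)) => //.
  + exact: (gdefinableC (d3 _ _ _ _ dF sub3
        (mul _ _ (Some true) (Some false) sub3) (var _ _ None))).
  + by move=> d /ga0; left.
  apply: (Utrue _) => j' /=.
  apply: (lh0 (fun p q r => ~ F (p * r)%g q)) => //.
  + exact: (gdefinableC (d3 _ _ _ _ dF sub2
        (mul _ _ (Some true) None sub2) (var _ _ (Some false)))).
  + exact: subset_trans (yA j') _.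
  apply: (Uneq _ j') => j jj'.
  apply: (lg0 (fun p q r => ~ F (r * p)%g q)) => //.
    exact: (gdefinableC (d3 _ _ _ _ dF subA
        (mul _ _ None (Some true) subA) (var _ _ (Some false)))).
  by apply: (Utrue _) => i; apply: nFy.
apply; apply: FF.
apply: (lh0 (fun p q r => F (p * r)%g r) g0 g0) => //.
  exact: (d3 _ _ _ _ dF sub2
        (mul _ _ (Some true) None sub2) (var _ _ None)).
apply: (Utrue _) => j /=.
apply: (lg0 (fun p q r => F (r * p)%g p) (y j) (y j)) => //.
  exact: (d3 _ _ _ _ dF subA
        (mul _ _ None (Some true) subA) (var _ _ (Some true))).
by apply: (Utrue _) => i /=; apply: Fy.
Qed.

End Pattern.

(** * Transfer to a central subgroup of finite index *)

Section Transfer.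
Context (H : groupType) (P K : set H) (Q : finType) (rho : H -> Q).
Hypotheses (P_subgroup : subgroup P) (K_subgroup : subgroup K).
Hypothesis KP : K `<=` P.
Hypothesis K_central : forall k p, K k -> P p -> commute k p.
(** [rho] labels the left cosets of [K] in [P]; that [Q] is finite makes the index finite. *)
Hypothesis rhoP : forall x y, P x -> P y -> rho x = rho y <-> K (y^-1 * x)%g.

(** Carries a commutative law, so that the product over the cosets can be reindexed as a [\big]
    operation. *)
Definition central_type := {z : H | z \in K}.
Implicit Types z : central_type.

Definition central_one : central_type := Sub 1%g (mem_set (subgroup1 K_subgroup)).

Definition central_mul z1 z2 : central_type := Sub (val z1 * val z2)%g
  (mem_set (subgroupM K_subgroup (set_mem (valP z1)) (set_mem (valP z2)))).

Lemma central_mulA : associative central_mul.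
Proof. by move=> x y z; apply: val_inj; rewrite /= mulgA. Qed.

Lemma central_mulC : commutative central_mul.
Proof.
move=> x y; apply: val_inj => /=.
by apply: K_central; [|apply: KP]; exact/set_mem/valP.
Qed.

Lemma central_mul1 : left_id central_one central_mul.
Proof. by move=> x; apply: val_inj; rewrite /= mul1g. Qed.

HB.instance Definition _ := Monoid.isComLaw.Build central_type central_one
  central_mul central_mulA central_mulC central_mul1.

Definition image_rho : {set Q} := [set q | `[< exists2 x, P x & rho x = q >]]%SET.

Lemma image_rhoP q : reflect (exists2 x, P x & rho x = q) (q \in image_rho).
Proof. by rewrite !inE; exact: asboolP. Qed.

Section Cocycle.
Context (t : Q -> H).
Hypothesis tP : forall q, q \in image_rho -> P (t q) /\ rho (t q) = q.

Definition coset_shift x q := rho (x * t q)%g.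

Lemma shift_image x q : P x -> q \in image_rho -> coset_shift x q \in image_rho.
Proof.
move=> Px /tP[Pt _]; apply/image_rhoP; exists (x * t q)%g => //.
exact: subgroupM.
Qed.

(** The correction [k] in [x * t q = t (coset_shift x q) * k], where [t] is a transversal. *)
Definition cocycle x q := ((t (coset_shift x q))^-1 * (x * t q))%g.

Lemma cocycleK x q : P x -> q \in image_rho -> K (cocycle x q).
Proof.
move=> Px Qq; have [Pt _] := tP Qq; have [Pt' e] := tP (shift_image Px Qq).
by apply/rhoP => //; exact: subgroupM.
Qed.

Lemma shiftM x y q : P x -> P y -> q \in image_rho ->
  coset_shift (x * y)%g q = coset_shift x (coset_shift y q).
Proof.
move=> Px Py Qq; have [Pt _] := tP Qq; have [Pt' e] := tP (shift_image Py Qq).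
apply/rhoP; do ?[exact: subgroupM]; first by do 2?apply: subgroupM.
by rewrite invgM -!mulgA mulKg; exact: cocycleK.
Qed.

Lemma cocycleM x y q : P x -> P y -> q \in image_rho ->
  cocycle (x * y)%g q = (cocycle x (coset_shift y q) * cocycle y q)%g.
Proof.
by move=> Px Py Qq; rewrite /cocycle shiftM // -!mulgA mulVKg.
Qed.

Lemma shift_inj x : P x -> {in image_rho &, injective (coset_shift x)}.
Proof.
move=> Px q q' Qq Qq' e.
have := shiftM (subgroupV P_subgroup Px) Px Qq.
rewrite e -shiftM //; last exact: subgroupV.
by rewrite mulVg /coset_shift !mul1g (tP Qq).2 (tP Qq').2.
Qed.

Lemma shift_onto x : P x -> (coset_shift x @: image_rho)%SET = image_rho.
Proof.
move=> Px; apply/eqP; rewrite eqEcard; apply/andP; split.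
  by apply/fintype.subsetP => _ /imsetP[q Qq ->]; exact: shift_image.
by rewrite card_in_imset //; exact: shift_inj.
Qed.

(** The classical transfer from [P] to [K]. For [x] in [P] each factor lies in [K], so the default
    of [insubd] is never taken. *)
Definition transfer x : central_type :=
  \big[central_mul/central_one]_(q in image_rho) insubd central_one (cocycle x q).

(** Multiply the cocycle identity over all cosets, reindexing the factors of [x] by the permutation
    [coset_shift y]. *)
Lemma transferM x y : P x -> P y ->
  transfer (x * y)%g = central_mul (transfer x) (transfer y).
Proof.
move=> Px Py; rewrite /transfer -{2}(shift_onto Py) big_imset /=; last exact: shift_inj.
rewrite -big_split /=; apply: eq_bigr => q Qq.
apply: val_inj => /=; rewrite !val_insubd !mem_set ?cocycleM //.
- exact: cocycleK.
- by apply: cocycleK => //; exact: shift_image.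
by rewrite -cocycleM //; apply: cocycleK => //; exact: subgroupM.
Qed.

(** A central [x] fixes every coset, and each of its cocycle values is [x] itself. *)
Lemma transfer_central x : K x -> val (transfer x) = (x ^+ #|image_rho|)%g.
Proof.
move=> Kx; rewrite /transfer.
have e q : q \in image_rho -> cocycle x q = x.
  move=> Qq; have [Pt tq] := tP Qq.
  have cx : (x * t q = t q * x)%g by exact: K_central.
  suff eq : coset_shift x q = q by rewrite /cocycle eq cx mulKg.
  rewrite /coset_shift -[RHS]tq; apply/rhoP => //.
    by apply: subgroupM => //; exact: KP.
  by rewrite cx mulKg.
rewrite -prodg_const.
rewrite (big_morph (val : central_type -> H) (id1 := 1%g) (op1 := *%g)%g) //.
by apply: eq_bigr => q Qq; rewrite val_insubd e // mem_set.
Qed.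

End Cocycle.

(** The transfer kills the commutator [d] because its target is commutative. By pigeonhole on cosets
    some [d ^+ n] with [n > 0] lies in [K], where the transfer is raising to the index; so a
    positive power of [d] is 1. *)
Lemma center_by_finite_abelian : torsion_free P -> abelian_group P.
Proof.
move=> tf x y Px Py.
have /choice[t tP] q : exists x, q \in image_rho -> P x /\ rho x = q.
  have [/image_rhoP[z]|] := boolP (q \in image_rho); first by exists z.
  by exists 1%g.
have MP := subgroupM P_subgroup.
pose d := [~ x, y]%g.
have PV := subgroupV P_subgroup.
have Pd : P d by exact: (MP _ _ (PV _ Px) (MP _ _ (PV _ Py) (MP _ _ Px Py))).
have Vd : transfer t d = central_one.
  have := transferM tP Px Py; rewrite central_mulC -transferM // commgC.
  rewrite transferM //; last exact: MP.
  move=> /(congr1 val) /= e; apply: val_inj => /=.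
  by apply: (@mulgI _ (val (transfer t (y * x)%g))); rewrite e mulg1.
have VdX n : transfer t (d ^+ n)%g = central_one.
  elim: n => [|n IH].
    rewrite expg0; apply: val_inj; rewrite transfer_central ?expg1n //.
    exact: subgroup1.
  rewrite expgS transferM ?Vd ?IH ?central_mul1 //; exact: subgroupX.
have [n n0 Kdn] : exists2 n, (0 < n)%N & K (d ^+ n)%g.
  have /injectivePn[i [j ij]] : ~~ injectiveb (fun i : 'I_#|Q|.+1 => rho (d ^+ i)%g).
    apply/negP => /injectiveP/leq_card; by rewrite card_ord ltnn.
  wlog lt_ij : i j ij / (i < j)%N.
    move=> wl; move: (ij); rewrite neq_ltn => /orP[lt|lt] e; first exact: (wl i j).
    by apply: (wl j i) => //; rewrite eq_sym.
  move=> /esym/rhoP h; exists (j - i)%N; first by rewrite subn_gt0.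
  rewrite expgnFr ?(ltnW lt_ij) //.
  have := h (subgroupX P_subgroup _ Pd) (subgroupX P_subgroup _ Pd).
  by rewrite -!expVgn (commuteX2 i j (commute_sym (commuteV (commute_refl d)))).
apply/commgP/eqP; apply: (tf _ (n * #|image_rho|)%N) => //.
  rewrite muln_gt0 n0; apply/card_gt0P; exists (rho 1%g).
  by apply/image_rhoP; exists 1%g => //; exact: subgroup1.
by rewrite expgnA -(transfer_central tP) // VdX.
Qed.

End Transfer.

(** * Finitely many conjugates under the centraliser of a power *)

Lemma conjg_commute (H : groupType) (x y : H) : (x ^ y)%g = x <-> commute x y.
Proof. by split=> [/conjg_fixP/commgP|/commgP/conjg_fixP]. Qed.

Section FiniteConjugates.
Context (H : groupType) (G : set H).
Hypotheses (G_subgroup : subgroup G) (G_torsion_free : torsion_free G).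

Lemma subgroupI (P Q : set H) : subgroup P -> subgroup Q -> subgroup (P `&` Q).
Proof.
move=> sP sQ; split=> [|x y]; rewrite !inE; first by split; exact: subgroup1.
by move=> [Px Qx] [Py Qy]; split; exact: subgroupF.
Qed.

Lemma subgroup_centralizer (S : set H) :
  subgroup [set u | forall s, S s -> commute u s].
Proof.
split=> [|x y]; rewrite !inE /=; first by move=> s _; exact/commute_sym/commute1.
move=> Sx Sy s Ss; apply/commute_sym/commuteM; first exact/commute_sym/Sx.
by apply/commuteV/commute_sym/Sy.
Qed.

(** [g] and [g ^ u] have the same [n]-th power. They lie in a center-by-finite subgroup, hence
    commute, and commuting elements with equal [n]-th powers coincide. *)
Lemma torsion_free_centralizer_expg g n : G g -> (0 < n)%N ->
  finite_set [set (g ^ u)%g | u in G `&` [set u | commute u (g ^+ n)%g]] ->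
  forall u, G u -> commute u (g ^+ n)%g -> commute u g.
Proof.
set E := G `&` _ => Gg n0 fS u Gu cu.
have sE : subgroup E.
  have -> : E = G `&` [set u | forall s, [set (g ^+ n)%g] s -> commute u s].
    apply/seteqP; split=> x [Gx] /=; first by move=> cx; split=> // _ ->.
    by move=> cx; split=> //; exact: cx.
  exact: subgroupI G_subgroup (subgroup_centralizer _).
set S := [set (g ^ u)%g | u in E] in fS.
have GE x : E x -> G x by case.
have powS s : S s -> (s ^+ n = g ^+ n)%g.
  by move=> [x [_ cx] <-]; rewrite -conjXg; apply/conjg_commute/commute_sym.
have SE s : S s -> E s.
  move=> Ss; split; last first.
    by rewrite -(powS s Ss); exact/commuteX/commute_refl.
  case: Ss => x [Gx _] <-.
  by apply: (subgroupM G_subgroup); [exact: subgroupV|exact: subgroupM].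
have SJ s x : S s -> E x -> S (s ^ x)%g.
  move=> [y Ey <-] Ex; exists (y * x)%g; last by rewrite conjgM.
  exact: (subgroupM sE).
pose C (T : set H) := [set u | forall s, T s -> commute u s].
(* [P] is the double centraliser of [S] inside [E]. [K] is central in [P] and is the kernel of its
   conjugation action on the finite set [S]. *)
pose K' := E `&` C S; pose P := E `&` C K'; pose K := P `&` K'.
have sC T : subgroup (C T) by exact: subgroup_centralizer.
have sP : subgroup P by exact: subgroupI.
have sK : subgroup K by do 2!apply: subgroupI => //.
have SP s : S s -> P s.
  by move=> Ss; split; [exact: SE|move=> k [_ Ck]; apply/commute_sym/Ck].
have [m [c Sc]] := finite_set_range fS.
have Scj j : S (c j) by rewrite Sc; exists j.
(* The action of [x] on [S], in indices. The inverse makes the fibres left cosets; [pick] chooses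
   one index even if [c] repeats values, and succeeds for [x] in [P] as [S] is stable under [E]. *)
pose rho x : {ffun 'I_m -> option 'I_m} :=
  [ffun i => [pick j | c j == (c i ^ x^-1)%g]].
have rhoP x y : P x -> P y -> rho x = rho y <-> K (y^-1 * x)%g.
  move=> Px Py.
  have Pyx : P (y^-1 * x)%g.
    by apply: (subgroupM sP) => //; exact: (subgroupV sP).
  have conjE i : (c i ^ x^-1 = c i ^ y^-1)%g <-> commute (y^-1 * x)%g (c i).
    have -> : commute (y^-1 * x)%g (c i) <-> (c i ^ (y^-1 * x))%g = c i.
      by rewrite conjg_commute; split; exact: commute_sym.
    rewrite conjgM; split=> [<-|e]; first by rewrite conjgKV.
    by rewrite -{1}e conjgK.
  split=> [e|[_ [_ Cyx]]].
    split=> //; split; first by case: Pyx.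
    move=> s; rewrite Sc => -[i _ <-]; apply/conjE.
    have := congr1 (fun f : {ffun _} => f i) e; rewrite !ffunE.
    case: pickP => [j /eqP <-|no _]; first by case: pickP => // j' /eqP <- [->].
    have := SJ _ _ (Scj i) (subgroupV sE Px.1); rewrite Sc => -[j _ ej].
    by have := no j; rewrite ej eqxx.
  apply/ffunP => i; rewrite !ffunE.
  by have /conjE -> : commute (y^-1 * x)%g (c i) by exact: Cyx.
have KP : K `<=` P by move=> k [].
have Kc k p : K k -> P p -> commute k p.
  by move=> [_ K'k] [_ Cp]; apply/commute_sym/Cp.
have tfP : torsion_free P by move=> x k [[Gx _] _]; exact: G_torsion_free.
have E1 : E 1%g by exact: subgroup1.
have Su : S (g ^ u)%g by exists u.
have Sg : S g by exists 1%g => //; rewrite conjg1.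
have cgu := center_by_finite_abelian sP sK KP Kc rhoP tfP (SP _ Sg) (SP _ Su).
apply/commute_sym/conjg_commute.
apply: (torsion_free_expg_inj G_subgroup G_torsion_free _ Gg (commute_sym cgu) n0).
  exact/GE/SE.
exact: powS.
Qed.

End FiniteConjugates.

(** * Torsion-free dp-minimal groups *)

Section TorsionFree.
Context {L : language} (kappa : Type) (M : structure L) (Gt : definable_group M).
Context (G : set Gt).
Hypothesis small_language : small kappa [set: formula L nat].
Hypothesis M_saturated : saturated kappa M.
Hypothesis G_subgroup : subgroup G.
Hypothesis G_dp_minimal : dp_minimal kappa [set dg_emb g | g in G].
Hypothesis G_torsion_free : torsion_free G.
Local Notation emb := (@dg_emb L M Gt).

Lemma defines_group_params (gs : seq Gt) : exists A : set M,
  [/\ finite_set A, defines_group Gt A &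
    forall g, g \in 1%g :: gs -> range (emb g) `<=` A].
Proof.
have [A0 fA0 dA0] := defines_group_finite Gt.
exists (A0 `|` \bigcup_(g in [set` 1%g :: gs]) range (emb g)); split.
- rewrite finite_setU; split=> //; apply: bigcup_finite => // g _.
  exact: finite_image.
- by apply: dA0 => d; left.
by move=> g gin d [i _ <-]; right; exists g.
Qed.

(** All [w j] commute with all [y i], so [y i * w j] commutes with [y i'] only if [y i] does, and
    dividing it by [w j'] and raising to the power [n] gives [g ^+ n] only if [w j = w j']. *)
Lemma conjugates_finite g n : G g -> (0 < n)%N ->
  finite_set [set (g ^ u)%g | u in G `&` [set u | commute u (g ^+ n)%g]].
Proof.
move=> Gg n0; apply: contrapT => /infinite_set_injection[y Sy y_inj].
have Gy i : G (y i).
  have [u [Gu _] <-] := Sy i.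
  by apply: (subgroupM G_subgroup); [exact: subgroupV|exact: subgroupM].
have yn i : (y i ^+ n = g ^+ n)%g.
  by have [u [_ cu] <-] := Sy i; rewrite -conjXg; apply/conjg_commute/commute_sym.
have g1 : g <> 1%g.
  move=> eg; suff : y 0 = y 1 by move=> /y_inj.
  by have [u _ <-] := Sy 0; have [v _ <-] := Sy 1; rewrite eg !conj1g.
have ny i j : i <> j -> ~ commute (y i) (y j).
  move=> ij cij; apply/ij/y_inj.
  by apply: (torsion_free_expg_inj G_subgroup G_torsion_free _ _ cij n0);
    rewrite ?yn.
pose w j := (g ^+ n ^+ j)%g.
have Gw j : G (w j) by apply: (subgroupX G_subgroup); exact: (subgroupX G_subgroup).
have yw i j : commute (y i) (w j).
  by rewrite /w -(yn i) -expgnA; exact/commuteX/commute_refl.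
have [A [fA dA pA]] := defines_group_params [:: (g ^+ n)%g].
have A1 : range (emb 1%g) `<=` A by apply: pA; rewrite inE eqxx.
have Agn : range (emb (g ^+ n)%g) `<=` A by apply: pA; rewrite !inE eqxx orbT.
apply: (@dp_minimal_pattern _ _ _ _ _ small_language M_saturated G_subgroup
  G_dp_minimal A (fun z u => (z * u)%g = (u * z)%g)
  (fun z u => ((z / u) ^+ n)%g = (g ^+ n)%g) y w) => //.
- by apply: gfun_eq => //; apply: gfun_mul => //; exact: gfun_var.
- apply: gfun_eq => //; last exact: (@gfun_const _ _ _ A _ _ Agn).
  apply: gfun_exp => //; apply: gfun_mul => //; first exact: gfun_var.
  by apply: gfun_inv => //; exact: gfun_var.
- move=> i j; apply: commute_sym; apply: commuteM => //.
- move=> i i' j ii' c; apply: (ny i' i); first by move=> e; apply: ii'.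
  have : commute (y i') (y i * w j * (w j)^-1)%g.
    by apply: commuteM; [exact: commute_sym|exact: commuteV].
  by rewrite mulgK.
- by move=> i j; rewrite mulgK.
move=> i j j' jj'; rewrite -mulgA expgMn; last first.
  by apply: commuteM => //; exact: commuteV.
rewrite yn -[RHS]mulg1 => /mulgI e; apply: jj'.
have ww : (w j / w j')%g = 1%g.
  by apply: (G_torsion_free _ n0 e); exact: subgroupF.
have gn1 : (g ^+ n)%g <> 1%g by move=> /(G_torsion_free Gg n0).
apply: (torsion_free_expgI G_torsion_free (subgroupX G_subgroup n Gg) gn1).
exact: divg1_eq.
Qed.

Lemma commute_expg g n u : G g -> (0 < n)%N -> G u ->
  commute u (g ^+ n)%g -> commute u g.
Proof.
move=> Gg n0; apply: torsion_free_centralizer_expg => //.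
exact: conjugates_finite.
Qed.

(** For [z = a ^+ i * b ^+ j], removing [a ^+ i'] on the left leaves an element commuting with [b]
    iff [a ^+ i] and [a ^+ i'] differ by a factor commuting with [b], which forces [i = i'];
    symmetrically on the right for [b] and [a]. *)
Lemma dp_minimal_torsion_free_abelian : abelian_group G.
Proof.
move=> a b Ga Gb; apply: contrapT => nab.
have [A [fA dA pA]] := defines_group_params [:: a; b].
have A1 : range (emb 1%g) `<=` A by apply: pA; rewrite inE eqxx.
have Aa : range (emb a) `<=` A by apply: pA; rewrite !inE eqxx orbT.
have Ab : range (emb b) `<=` A by apply: pA; rewrite !inE eqxx !orbT.
(* Up to inversion the quotient is a positive power of [c], and by [commute_expg] whatever commutes
   with it commutes with [c]. *)
have na c d i j : G c -> G d -> ~ commute c d -> i <> j ->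
    ~ commute (c ^- i * c ^+ j)%g d.
  move=> Gc Gd ncd.
  have lt k l : (k < l)%N -> ~ commute (c ^- k * c ^+ l)%g d.
    move=> kl; rewrite -(subnKC (ltnW kl)) expgnDr mulKg => /commute_sym cc.
    apply/ncd/commute_sym; apply: commute_expg cc => //; by rewrite subn_gt0.
  move=> ij; case: (ltngtP i j) => // [|ji]; first exact: lt.
  have -> : (c ^- i * c ^+ j = (c ^- j * c ^+ i)^-1)%g by rewrite invgM invgK.
  by move=> /commute_sym/commuteV; rewrite invgK => /commute_sym; exact: lt.
apply: (@dp_minimal_pattern _ _ _ _ _ small_language M_saturated G_subgroup
  G_dp_minimal A (fun z u => (u^-1 * z * b)%g = (b * (u^-1 * z))%g)
  (fun z u => (z / u * a)%g = (a * (z / u))%g)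
  (fun i => a ^+ i)%g (fun j => b ^+ j)%g) => //.
- have d1 : gfun A (fun v : bool -> Gt => ((v false)^-1 * v true)%g).
    by apply: gfun_mul => //; [apply: gfun_inv => //|]; exact: gfun_var.
  have db : gfun A (fun _ : bool -> Gt => b) by exact: gfun_const.
  by apply: gfun_eq => //; apply: gfun_mul.
- have d1 : gfun A (fun v : bool -> Gt => (v true / v false)%g).
    by apply: gfun_mul => //; [|apply: gfun_inv => //]; exact: gfun_var.
  have da : gfun A (fun _ : bool -> Gt => a) by exact: gfun_const.
  by apply: gfun_eq => //; apply: gfun_mul.
- by move=> i; exact: subgroupX.
- by move=> j; exact: subgroupX.
- by move=> i j; rewrite mulKg; exact/commute_sym/commuteX/commute_refl.
- move=> i i' j ii'; rewrite mulgA => cb; apply: (na a b i' i) => //.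
    by move=> e; apply: ii'.
  have : commute b (a ^- i' * a ^+ i * b ^+ j / b ^+ j)%g.
    apply: commuteM; first exact: commute_sym.
    exact/commuteV/commuteX/commute_refl.
  by rewrite mulgK => /commute_sym.
- by move=> i j; rewrite mulgK; exact/commute_sym/commuteX/commute_refl.
move=> i j j' jj' ca; apply: (na b a j' j) => //.
- by move=> /commute_sym.
- by move=> e; apply: jj'.
have -> : (b ^- j' * b ^+ j = b ^+ j / b ^+ j')%g.
  by apply/commute_sym/commuteV/commuteX2/commute_refl.
have : commute a (a ^- i * (a ^+ i * b ^+ j / b ^+ j'))%g.
  apply: commuteM; last exact: commute_sym.
  exact/commuteV/commuteX/commute_refl.
by rewrite -[(a ^+ i * _ / _)%g]mulgA mulKg => /commute_sym.
Qed.

End TorsionFree.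

Theorem theorem2 (L : language) (T : set (sentence L))
    (T_complete : complete T) (T_NIP : NIP T)
    (kappa : Type) (C : structure L)
    (C_models : models C T) (C_monster : monster kappa C)
    (Gt : definable_group C) (G : set Gt)
    (G_subgroup : subgroup G)
    (G_type_definable : type_definable kappa [set dg_emb g | g in G])
    (G_dp_minimal : dp_minimal kappa [set dg_emb g | g in G])
    (G_torsion_free : torsion_free G) :
  abelian_group G.
Proof.
have [small_language C_saturated _] := C_monster.
exact: (dp_minimal_torsion_free_abelian small_language C_saturated).
Qed.
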